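(* There is a randomized $2$-round algorithm that, for any $\delta>0$ and $B\ge 1$, recovers any hidden $B$-balanced $k$-clustering of an $n$-point universe with probability at least $1-\delta$ using \[ O\left(\sqrt{B}\cdot n\log\Big(\frac{\log k}{\delta}\Big)\right) \] subset queries. In particular, if $B$ is a constant and $\delta=1/\mathrm{poly}\log k$, the query complexity is $O(n\log\log k)$.
   Context: Let $U$ be a set of $n$ points with a hidden partition $U=C_1\sqcup\cdots\sqcup C_k$. For $B\ge1$ it is $B$-balanced if $\frac{n}{Bk}\le|C_i|\le\frac{Bn}{k}$ for all $i$. A subset query on $S\subseteq U$ returns $\mathsf{count}(S)=|\{i\in[k]: C_i\cap S\neq\emptyset\}|$. A $2$-round algorithm specifies a first batch of queries, receives all answers, then (depending on these answers) specifies a second batch of queries, receives all answers, and then outputs the clustering. *)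

(* Defs.v *)
From HB Require Import structures.
From mathcomp Require Import all_boot all_order all_algebra.
From mathcomp Require Import reals.

Set Implicit Arguments.
Unset Strict Implicit.
Unset Printing Implicit Defensive.

Import Order.TTheory GRing.Theory Num.Theory.
Local Open Scope ring_scope.

(* A hidden clustering of U is an unlabelled partition P : {set {set U}}.      *)
(* For nonempty U, balancedness forces every cluster to be nonempty, so        *)
(* working with the set of clusters instead of a k-tuple loses nothing.        *)
Definition balanced_clustering (R : realType) (U : finType) (k : nat) (B : R)
    (P : {set {set U}}) : Prop :=
  [/\ partition P [set: U], #|P| = k &
      forall C, C \in P ->
        #|U|%:R / (B * k%:R) <= #|C|%:R /\ #|C|%:R <= B * #|U|%:R / k%:R].

Definition count_query (U : finType) (P : {set {set U}}) (S : {set U}) : nat :=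
  #|[set C in P | C :&: S != set0]|.

(* The answers to a batch are given in the order of the queries. *)
Record two_round_alg (U : finType) := TwoRoundAlg {
  batch1 : seq {set U};
  batch2 : seq nat -> seq {set U};
  output : seq nat -> seq nat -> {set {set U}}
}.

Section Run.
Variables (U : finType) (D : two_round_alg U) (P : {set {set U}}).

Definition answers1 : seq nat := map (count_query P) (batch1 D).
Definition answers2 : seq nat := map (count_query P) (batch2 D answers1).
Definition result : {set {set U}} := output D answers1 answers2.
Definition num_queries : nat :=
  (size (batch1 D) + size (batch2 D answers1))%N.

End Run.

(* A randomized algorithm is a distribution over deterministic ones; the same  *)
(* seed is available in both rounds and when producing the output.             *)
Record rand_two_round_alg (R : realType) (U : finType) := RandTwoRoundAlg {
  seed : finType;
  seed_prob : seed -> R;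
  seed_prob_ge0 : forall w, 0 <= seed_prob w;
  seed_prob_sum1 : \sum_(w : seed) seed_prob w = 1;
  run : seed -> two_round_alg U
}.

Definition success_prob (R : realType) (U : finType)
    (A : rand_two_round_alg R U) (P : {set {set U}}) : R :=
  \sum_(w : seed A | result (run w) P == P) seed_prob w.

(* The query bound q is a worst-case one: it holds for every seed. *)
Definition recovers_balanced (R : realType) (U : finType)
    (A : rand_two_round_alg R U) (k : nat) (B delta q : R) : Prop :=
  forall P : {set {set U}}, balanced_clustering k B P ->
    1 - delta <= success_prob A P /\
    forall w : seed A, (num_queries (run w) P)%:R <= q.

(* Main.v *)
Require Import Defs.
From HB Require Import structures.
From mathcomp Require Import all_boot all_order all_algebra.
From mathcomp Require Import boolp reals exp.
From mathcomp Require Import zify ring lra.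

(* Let T_1, ..., T_t be random subsets of the universe and let the signature of
   a point x record which T_i miss the cluster of x. For a T_i whose density is
   about the inverse of the size of a cluster C, the sets C and C' (any other
   cluster) are told apart by T_i with constant probability; O(1 + log B)
   densities suffice for a B-balanced clustering, so O((1 + log B) log(k/delta))
   sets T_i separate all clusters with probability 1 - delta/2.

   If the points of Q lie in distinct clusters, then count(T u Q) - count(T) is
   the number of x in Q whose cluster misses T. Hence the signature bits of an
   independent group of s points are the unknowns of a coin-weighing problem,
   which a Cantor-Mills design solves with O(s / log s) subset sums.

   The first round tests random groups of s ~ (k/B)^(Omega(1)) points for
   independence. O((n/s) log(log k/delta)) groups leave at most n/log k points
   uncovered with probability 1 - delta/2 (first moment); these points are
   probed one by one. For delta <= 1/k every point is probed individually in the
   second round, and there is no first round. *)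

Set Implicit Arguments.
Unset Strict Implicit.
Unset Printing Implicit Defensive.

Import Order.TTheory GRing.Theory Num.Theory.

(** * Coin weighing *)

Section CoinWeighing.
Variable T : eqType.

(** In closed form [j * 2 ^ j + 1]; the summand [(2 ^ j'.+1).-1] is the number of weighings of the
    design for [j']. *)
Fixpoint weighing_capacity (j : nat) : nat :=
  if j is j'.+1 then 2 * weighing_capacity j' + (2 ^ j'.+1).-1 else 1.

(* The Cantor-Mills design: a design with [q] weighings for [n] coins yields
   one with [2 q + 1] weighings for [2 n + q] coins. *)
Fixpoint weighings (j : nat) (xs : seq T) : seq (seq T) :=
  if j is j'.+1 then
    let n := weighing_capacity j' in
    let x := take n xs in
    let y := take n (drop n xs) in
    let z := drop n (drop n xs) in
    let D i := nth [::] (weighings j' x) i in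
    let E i := nth [::] (weighings j' y) i in
    let q := (2 ^ j'.+1).-1 in
    y :: mkseq (fun i => D i ++ (E i ++ take 1 (drop i z))) q
      ++ mkseq (fun i => D i ++ [seq u <- y | u \notin E i]) q
  else [:: xs].

Lemma size_weighings j xs : size (weighings j xs) = (2 ^ j.+1).-1.
Proof.
case: j => [//|j] /=; rewrite size_cat !size_mkseq.
by rewrite [in RHS]expnS; have := expn_gt0 2 j.+1; lia.
Qed.

Lemma weighings_subseq j xs Q : Q \in weighings j xs -> subseq Q xs.
Proof.
elim: j xs Q => [|j IH] xs Q /=; first by rewrite inE => /eqP ->.
set n := weighing_capacity j.
set x := take n xs; set y := take n _; set z := drop n _; set q := _.-1.
have -> : xs = x ++ (y ++ z) by rewrite /x /y /z !cat_take_drop.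
have subn t i : i < q -> subseq (nth [::] (weighings j t) i) t.
  by move=> iq; apply/IH/mem_nth; rewrite size_weighings.
rewrite inE mem_cat => /or3P[/eqP->|/mapP[i]|/mapP[i]].
- by rewrite -[y in subseq y _](cats0 y) -[_ ++ [::]]cat0s !cat_subseq ?sub0seq.
- rewrite mem_iota add0n => /= iq ->.
  rewrite !cat_subseq ?subn//.
  by apply: (subseq_trans (take_subseq _ _)); apply: drop_subseq.
- rewrite mem_iota add0n => /= iq ->.
  rewrite cat_subseq ?subn// -[[seq _ <- _ | _]]cats0.
  by rewrite cat_subseq ?sub0seq ?filter_subseq.
Qed.

Lemma count_subseq_compl (b : pred T) (s t : seq T) :
  uniq t -> subseq s t ->
  count b t = count b s + count b [seq u <- t | u \notin s].
Proof.
move=> ut /(subseq_uniqP ut) es; rewrite {1}es -count_cat.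
by apply/permP; rewrite perm_sym (perm_filterC [in s] t).
Qed.

(* The parity of the sum of the [i]-th weighings of the two halves reveals the
   [i]-th extra coin; the rest is then linear. *)
Lemma weighings_detect j xs (b b' : pred T) :
  uniq xs -> size xs <= weighing_capacity j ->
  (forall Q, Q \in weighings j xs -> count b Q = count b' Q) ->
  {in xs, b =1 b'}.
Proof.
elim: j xs => [|j IH] xs uxs.
  case: xs uxs => [//|x [|//]] _ _ /(_ [:: x]); rewrite inE eqxx => /(_ isT) /=.
  by rewrite !addn0 => bb' y; rewrite inE => /eqP->; case: (b x) (b' x) bb' => [] [].
rewrite [weighing_capacity _]/= [weighings _ _]/=.
set n := weighing_capacity j.
set x := take n xs; set y := take n _; set z := drop n _; set q := _.-1.
have exs : xs = x ++ (y ++ z) by rewrite /x /y /z !cat_take_drop.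
move=> sxs H.
have sx : size x <= n by rewrite size_take; case: ltnP.
have sy : size y <= n by rewrite size_take; case: ltnP.
have sz : size z <= q by rewrite !size_drop; lia.
move: uxs; rewrite exs !cat_uniq => /and3P[ux _ /and3P[uy _ uz]].
have cy : count b y = count b' y by apply: H; rewrite inE eqxx.
have key i : i < q ->
  [/\ count b (nth [::] (weighings j x) i) = count b' (nth [::] (weighings j x) i),
      count b (nth [::] (weighings j y) i) = count b' (nth [::] (weighings j y) i) &
      count b (take 1 (drop i z)) = count b' (take 1 (drop i z))].
  move=> iq; set D := nth _ _ i; set E := nth _ _ i.
  have sE : subseq E y.
    by apply: (@weighings_subseq j); rewrite mem_nth ?size_weighings.
  have H1 : count b (D ++ (E ++ take 1 (drop i z))) =
            count b' (D ++ (E ++ take 1 (drop i z))).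
    apply: H; rewrite inE mem_cat; apply/or3P; apply: Or32.
    by apply/mapP; exists i; rewrite ?mem_iota.
  have H2 : count b (D ++ [seq u <- y | u \notin E]) =
            count b' (D ++ [seq u <- y | u \notin E]).
    apply: H; rewrite inE mem_cat; apply/or3P; apply: Or33.
    by apply/mapP; exists i; rewrite ?mem_iota.
  move: H1 H2; rewrite !count_cat.
  (* [E] and its complement add up to the count of [y], itself a weighing, so [H1] and [H2] sum to
     twice the count of [D], plus that of [y], plus the bit of the extra coin. *)
  have := count_subseq_compl b uy sE; have := count_subseq_compl b' uy sE.
  have szi (c : pred T) : count c (take 1 (drop i z)) <= 1.
    by apply: leq_trans (count_size _ _) _; rewrite size_take; case: ltnP.
  have := szi b; have := szi b'; move: cy; clear=> *; split; lia.
move=> u; rewrite !mem_cat => /or3P[ux'|uy'|uz'].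
- apply: (IH x) => // Q /(nthP [::])[i]; rewrite size_weighings => iq <-.
  by case: (key i iq).
- apply: (IH y) => // Q /(nthP [::])[i]; rewrite size_weighings => iq <-.
  by case: (key i iq).
- have iz : index u z < size z by rewrite index_mem.
  have [_ _] := key _ (leq_trans iz sz).
  rewrite (drop_nth u iz) nth_index //= take0 /= !addn0.
  by case: (b u) (b' u) => [] [].
Qed.

Lemma weighing_capacity_gt0 j : 0 < weighing_capacity j.
Proof. by elim: j => [//|j IH]; rewrite [weighing_capacity _]/= addn_gt0 muln_gt0 IH. Qed.

Lemma weighing_capacity_le j : weighing_capacity j <= 4 ^ j.
Proof.
elim: j => [|j IH] //=; rewrite !expnS.
have : 2 ^ j <= 4 ^ j by case: (j) => [|e] //; rewrite leq_exp2r.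
by have := expn_gt0 2 j; lia.
Qed.

(** The logarithmic gain: with [size_weighings], a full group costs O(1 / (j + 1)) weighings per
    coin. *)
Lemma weighing_capacity_ge j : 2 ^ j * (j + 2) <= 2 * weighing_capacity j.
Proof.
elim: j => [|j IH] //=; rewrite !expnS.
by have := expn_gt0 2 j; nia.
Qed.

End CoinWeighing.

(** * Decoding the answers *)

Section Queries.
Variable U : finType.
Implicit Types (P : {set {set U}}) (Q g : seq U) (S : {set U}).

Lemma partition_pblockP P (C : {set U}) x :
  partition P [set: U] -> C \in P -> (x \in C) = (pblock P x == C).
Proof.
case/and3P=> /eqP cP tiP _ CP; apply/idP/eqP => [xC|<-].
  exact: def_pblock tiP CP xC.
by rewrite mem_pblock cP inE.
Qed.

Lemma count_query_seq P Q : partition P [set: U] ->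
  count_query P [set x in Q] = size (undup (map (pblock P) Q)).
Proof.
move=> pP; rewrite /count_query -(card_uniqP (undup_uniq _)); apply: eq_card => C.
rewrite !inE mem_undup; apply/andP/mapP => [[CP /set0Pn[x]]|[x xQ ->]].
  rewrite !inE (partition_pblockP _ pP CP) => /andP[/eqP <- xQ].
  by exists x.
have /and3P[/eqP cP _ _] := pP.
have xP : x \in cover P by rewrite cP inE.
by split; [exact: pblock_mem | apply/set0Pn; exists x; rewrite !inE mem_pblock xP].
Qed.

Lemma count_query_independent P Q : partition P [set: U] ->
  (count_query P [set x in Q] == size Q) = uniq (map (pblock P) Q).
Proof.
move=> pP; rewrite count_query_seq // -[uniq _]negbK -ltn_size_undup.
by rewrite size_map -leqNgt eqn_leq -{1}(size_map (pblock P) Q) size_undup.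
Qed.

(** The clusters newly hit by [Q] are the blocks of those points of [Q] whose block misses [S];
    independence makes these blocks distinct, so counting points counts clusters. *)
Lemma count_queryU P S Q : partition P [set: U] -> uniq (map (pblock P) Q) ->
  count_query P (S :|: [set x in Q]) =
  count_query P S + count (fun x => pblock P x :&: S == set0) Q.
Proof.
move=> pP uQ; have /and3P[/eqP cP _ _] := pP.
rewrite /count_query -(cardsID [set C in P | C :&: S != set0]); congr (_ + _).
  apply: eq_card => C; rewrite !inE setIUr setU_eq0 negb_and.
  by case: (C \in P); case: (C :&: S == set0); rewrite ?andbF ?andbT.
have -> : count (fun x => pblock P x :&: S == set0) Q =
  size [seq C <- map (pblock P) Q | C :&: S == set0].
  by rewrite size_filter count_map.
rewrite -(card_uniqP (filter_uniq _ uQ)); apply: eq_card => C.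
rewrite !inE mem_filter setIUr setU_eq0 negb_and.
case: (C :&: S =P set0) => [_|]; rewrite ?andbT ?andbF ?orbT /=; last first.
  by case: (C \in P).
apply/andP/mapP => [[CP /set0Pn[x]]|[x xQ ->]].
  rewrite !inE (partition_pblockP _ pP CP) => /andP[/eqP <- xQ].
  by exists x.
have xP : x \in cover P by rewrite cP inE.
by split; [exact: pblock_mem | apply/set0Pn; exists x; rewrite !inE mem_pblock xP].
Qed.

Definition signature (Ts : seq {set U}) P (x : U) : seq bool :=
  [seq pblock P x :&: T == set0 | T <- Ts].

Definition separated (Ts : seq {set U}) P : bool :=
  [forall x, forall y, (signature Ts P x == signature Ts P y) ==>
                       (pblock P x == pblock P y)].

(** A signature depends on its point only through the cluster, so under separation its fibres are
    the clusters. *)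
Lemma preim_partition_signature Ts P : partition P [set: U] ->
  separated Ts P -> preim_partition (signature Ts P) [set: U] = P.
Proof.
move=> pP sP; rewrite -[RHS](preim_partition_pblock pP).
apply: eq_in_imset => x _; apply/setP => y; rewrite !inE /=.
apply/eqP/eqP => [e|]; last by rewrite /signature => ->.
by have /forallP/(_ x)/forallP/(_ y)/implyP := sP; rewrite e eqxx => /(_ isT)/eqP.
Qed.

Variables (groups : seq (seq U)) (Ts : seq {set U}) (j m : nat).

Definition independent_groups (a : seq nat) : seq (seq U) :=
  [seq ga.1 | ga <- zip groups a & ga.2 == size ga.1].

Definition uncovered (gs : seq (seq U)) : {set U} :=
  [set x | all (fun g => x \notin g) gs].

(** The empty probe asks for [T] alone and supplies the baseline for the other counts. *)
Definition probes (gs : seq (seq U)) : seq (seq U) :=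
  [::] :: [seq [:: x] | x <- enum (uncovered gs)]
       ++ flatten [seq weighings j g | g <- gs].

Definition round1 : seq {set U} := [seq [set x in g] | g <- groups].

(* No second batch at all when more than [m] points are uncovered: this makes
   the query bound hold for every seed. *)
Definition round2 (a : seq nat) : seq {set U} :=
  let gs := independent_groups a in
  if #|uncovered gs| <= m then
    [seq T :|: [set x in Q] | T <- Ts, Q <- probes gs]
  else [::].

Definition consistent (a1 a2 : seq nat) P : bool :=
  [&& partition P [set: U], map (count_query P) round1 == a1 &
      map (count_query P) (round2 a1) == a2].

(** Decoding is by exhaustive search. The candidate found need not be the hidden partition: only its
    signatures are shown to agree, hence the output is rebuilt from these. *)
Definition cluster_alg : two_round_alg U := {|
  batch1 := round1;
  batch2 := round2;
  output := fun a1 a2 =>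
    if [pick P | consistent a1 a2 P] is Some P
    then preim_partition (signature Ts P) [set: U] else set0 |}.

Lemma independent_groupsE P : partition P [set: U] ->
  independent_groups (map (count_query P) round1) =
  [seq g <- groups | uniq (map (pblock P) g)].
Proof.
move=> pP; rewrite /independent_groups /round1 -map_comp.
elim: groups => //= g gs IH.
by rewrite (count_query_independent g pP); case: ifP => /=; rewrite IH.
Qed.

(** The hidden [P] is consistent, so some candidate [P'] is found. Bits of uncovered points are
    compared by singleton probes, those of covered points by the weighings of an independent
    group. *)
Lemma cluster_alg_correct P : partition P [set: U] ->
  (forall g, g \in groups -> size g <= weighing_capacity j) ->
  #|uncovered [seq g <- groups | uniq (map (pblock P) g)]| <= m ->
  separated Ts P -> result cluster_alg P = P.
Proof.
move=> pP sg; rewrite -(independent_groupsE pP) => um sP.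
rewrite /result /= /answers2 /answers1 /=.
case: pickP => [P' /and3P[pP' /eqP e1 /eqP e2]|/(_ P)]; last first.
  by rewrite /consistent pP !eqxx.
rewrite -[RHS](preim_partition_signature pP sP).
suff sE x : signature Ts P' x = signature Ts P x.
  by apply: eq_in_imset => x _; apply/setP => y; rewrite !inE /= !sE.
apply/eq_in_map => T TTs.
move: e2; rewrite /round2 um; set a1 := map _ round1.
set gs := independent_groups a1 => e2.
have e2' Q : Q \in probes gs ->
    count_query P' (T :|: [set x in Q]) = count_query P (T :|: [set x in Q]).
  move=> Qp; have /eq_in_map := e2; apply.
  by apply/allpairsP; exists (T, Q).
have eT : count_query P' T = count_query P T.
  have -> : T = T :|: [set x in [::]] by apply/setP => z; rewrite !inE orbF.
  by apply: e2'; rewrite inE.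
pose b P0 x := pblock P0 x :&: T == set0.
have bQ Q : Q \in probes gs -> uniq (map (pblock P') Q) ->
    uniq (map (pblock P) Q) -> count (b P') Q = count (b P) Q.
  move=> Qp u' u; have := e2' Q Qp; rewrite !count_queryU // eT.
  exact: addnI.
rewrite -/(b P' x) -/(b P x).
have [xu|] := boolP (x \in uncovered gs).
  have := bQ [:: x]; rewrite inE mem_cat map_f ?mem_enum // => /(_ isT isT isT) /=.
  by rewrite !addn0; case: (b P' x) (b P x) => [] [].
rewrite inE -has_predC => /hasP[g gg /=]; rewrite negbK => xg.
have ug : uniq (map (pblock P) g).
  by move: gg; rewrite /gs /a1 (independent_groupsE pP) mem_filter => /andP[].
(* The first-round answers coincide, so [g] is independent for [P'] too and its weighings are sums
   of bits for both partitions. *)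
have ug' : uniq (map (pblock P') g).
  by move: gg; rewrite /gs /a1 -e1 (independent_groupsE pP') mem_filter => /andP[].
have gin : g \in groups.
  by move: gg; rewrite /gs /a1 (independent_groupsE pP) mem_filter => /andP[].
apply: (@weighings_detect _ j g (b P') (b P) (map_uniq ug) (sg _ gin)) xg => Q Qg.
have sQ := weighings_subseq Qg.
apply: bQ; [|exact: subseq_uniq (map_subseq _ sQ) ug'
                |exact: subseq_uniq (map_subseq _ sQ) ug].
rewrite inE mem_cat; apply/or3P; apply: Or33.
by apply/flattenP; exists (weighings j g) => //; apply: map_f.
Qed.

Lemma cluster_alg_num_queries P :
  num_queries cluster_alg P <=
  size groups + size Ts * (1 + m + size groups * (2 ^ j.+1).-1).
Proof.
rewrite /num_queries /= /round1 size_map leq_add2l /round2.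
case: ifP => // um; rewrite size_allpairs leq_mul2l; apply/orP; right.
rewrite /probes /= size_cat size_map -cardE -addnA add1n ltnS leq_add //.
rewrite size_flatten /shape -map_comp.
set gs := independent_groups _.
have -> : [seq (size \o [eta weighings j]) i | i <- gs] =
          nseq (size gs) (2 ^ j.+1).-1.
  by elim: gs {um} => //= g gs ->; rewrite size_weighings.
rewrite sumn_nseq mulnC leq_mul2r; apply/orP; right.
rewrite /gs /independent_groups size_map size_filter.
by apply: leq_trans (count_size _ _) _; rewrite size_zip geq_minl.
Qed.

End Queries.

(** * Random groups *)

(** Bernoulli's inequality [(1 + y / w) ^ d >= 1 + d * y / w], multiplied by [w ^ d.+1] to stay in
    [nat]. *)
Lemma bernoulli_addn w y d : w ^ d * (w + d * y) <= w * (w + y) ^ d.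
Proof.
elim: d => [|d IH]; first by rewrite !expn0 mul0n addn0 mul1n muln1.
have : w ^ d * (w + d * y) * (w + y) <= w * (w + y) ^ d * (w + y).
  by rewrite leq_mul2r IH orbT.
by rewrite !expnS; nia.
Qed.

(** Likewise [(1 - t / M) ^ d >= 1 - d * t / M], with the negative term moved across because
    subtraction truncates. *)
Lemma bernoulli_subn M t d : t <= M ->
  M ^ d * M <= M ^ d * (d * t) + (M - t) ^ d * M.
Proof.
move=> tM; elim: d => [|d IH]; first by rewrite !expn0; lia.
have : M ^ d * M * (M - t) <= (M ^ d * (d * t) + (M - t) ^ d * M) * (M - t).
  by rewrite leq_mul2r IH orbT.
rewrite !expnS; move: (M - t) (subnKC tM) => w eM.
by rewrite -eM in IH *; nia.
Qed.

(** For [y < G], Bernoulli gives [(G / (G - y)) ^ d >= 1 + d * y / (G - y) >= 2]. *)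
Lemma expn_sub_half G y d : 0 < G -> y <= G -> G <= d * y ->
  2 * (G - y) ^ d <= G ^ d.
Proof.
move=> G0 yG Gdy; have := bernoulli_addn (G - y) y d.
rewrite subnK //; have [->|w0] := posnP (G - y).
  by case: d Gdy => [|d] h _; [lia | rewrite exp0n].
move=> h; rewrite -(leq_pmul2l w0); apply: leq_trans h.
have : (G - y) ^ d * (2 * (G - y)) <= (G - y) ^ d * (G - y + d * y).
  by rewrite leq_mul2l; apply/orP; right; lia.
by apply: leq_trans; rewrite leq_eqVlt; apply/orP; left; apply/eqP; ring.
Qed.

Lemma leq_card_bigcup (I T : finType) (P : pred I) (F : I -> {set T}) :
  #|\bigcup_(i | P i) F i| <= \sum_(i | P i) #|F i|.
Proof.
elim/big_rec2: _ => [|i c A _ IH]; first by rewrite cards0.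
by apply: leq_trans (leq_card_setU _ _) _; rewrite leq_add2l.
Qed.

(** * Changing one coordinate of a uniform tuple *)

Section Resampling.
Variables I U : finType.
Implicit Types (g : {ffun I -> U}) (b : I) (v : U).

Lemma card_ffun_family (F : I -> {set U}) :
  #|[set g : {ffun I -> U} | [forall i, g i \in F i]]| = \prod_i #|F i|.
Proof.
transitivity #|(family (fun i => mem (F i)) : simpl_pred {ffun I -> U})|.
  by apply: eq_card => g; rewrite !inE; apply/forallP/forallP.
by rewrite card_family foldrE big_image.
Qed.

Definition resample g b v : {ffun I -> U} :=
  [ffun i => if i == b then v else g i].

Lemma resample_at g b v : resample g b v b = v.
Proof. by rewrite ffunE eqxx. Qed.

Lemma resample_ne g b v i : i != b -> resample g b v i = g i.
Proof. by rewrite ffunE => /negPf->. Qed.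

Lemma resampleK g b v : resample (resample g b v) b (g b) = g.
Proof. by apply/ffunP => i; rewrite !ffunE; case: eqP => // ->. Qed.

(** Conditioning on all coordinates but [b]. Pairs [(g, v)] with [g] in [A] and [resample g b v] in
    [E] are counted twice: each [g] has at most [c] of them, and exchanging [g b] with [v] is an
    involution embedding [E] times [U] into them. *)
Lemma card_resample b c (A E : {set {ffun I -> U}}) :
  (forall g v, g \in A -> resample g b v \in A) -> E \subset A ->
  (forall g, g \in A -> #|[set v | resample g b v \in E]| <= c) ->
  #|U| * #|E| <= c * #|A|.
Proof.
move=> stA sEA fib.
pose Z := [set gv : {ffun I -> U} * U | (gv.1 \in A) && (resample gv.1 b gv.2 \in E)].
have ZE : #|Z| <= c * #|A|.
  rewrite -sum1_card (eq_bigl (fun gv : {ffun I -> U} * U =>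
    (gv.1 \in A) && (resample gv.1 b gv.2 \in E))); last by move=> gv; rewrite inE.
  rewrite -(pair_big_dep (mem A) (fun g v => resample g b v \in E) (fun _ _ => 1)) /=.
  rewrite mulnC -sum_nat_const; apply: leq_sum => g gA.
  by rewrite sum1_card -cardsE; exact: fib.
apply: leq_trans ZE; rewrite mulnC -cardsT -cardsX.
pose phi (gv : {ffun I -> U} * U) := (resample gv.1 b gv.2, gv.1 b).
have phiK : involutive phi.
  by move=> [g v]; rewrite /phi /= resampleK resample_at.
apply: (@leq_trans #|phi @: setX E setT|).
  by rewrite (card_imset _ (inv_inj phiK)).
apply: subset_leq_card.
apply/subsetP => _ /imsetP[[g v] /setXP[/= gE _] ->].
by rewrite inE /= resampleK gE stA // (subsetP sEA).
Qed.

End Resampling.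

Section RandomGroups.
Variables (U : finType) (K : eqType) (kappa : U -> K) (s m : nat).
Hypothesis fibre_le : forall y, #|[set v | kappa v == y]| <= m.
Hypothesis sm : 2 * (s.-1 ^ 2 * m) <= #|U|.
Implicit Types g : {ffun 'I_s -> U}.

Definition independent g : bool := injectiveb (fun i => kappa (g i)).

Definition covers g x : bool := independent g && (x \in codom g).

(** Birthday bound: each of the [s.-1] positions other than [a] collides with another one with
    probability at most [s.-1 * m / #|U|], and [sm] makes the sum at most 1/2. *)
Lemma card_independent_at (a : 'I_s) (x : U) :
  #|[set g : {ffun 'I_s -> U} | g a == x]| <=
  2 * #|[set g | independent g && (g a == x)]|.
Proof.
set A := [set g : {ffun 'I_s -> U} | g a == x].
have s0 : 0 < #|U| by apply/card_gt0P; exists x.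
pose E b := [set g in A | [exists c, (c != b) && (kappa (g c) == kappa (g b))]].
have cE b : b != a -> #|U| * #|E b| <= s.-1 * m * #|A|.
  move=> ba; apply: (@card_resample _ _ b).
  - by move=> g v; rewrite !inE resample_ne 1?eq_sym.
  - by apply/subsetP => g; rewrite inE => /andP[].
  move=> g gA.
  apply: (@leq_trans #|\bigcup_(c | c != b) [set v | kappa v == kappa (g c)]|).
    apply: subset_leq_card; apply/subsetP => v; rewrite !inE => /andP[_].
    case/existsP=> c /andP[cb]; rewrite resample_at resample_ne // => e.
    by apply/bigcupP; exists c => //; rewrite inE eq_sym.
  apply: leq_trans (leq_card_bigcup _ _) _.
  rewrite -[s in s.-1]card_ord -(cardC1 b) -sum_nat_const.
  exact: leq_sum.
have bad : #|U| * #|[set g in A | ~~ independent g]| <= s.-1 ^ 2 * m * #|A|.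
  apply: (@leq_trans (#|U| * \sum_(b | b != a) #|E b|)).
    rewrite leq_mul2l; apply/orP; right.
    apply: leq_trans (leq_card_bigcup _ _); apply: subset_leq_card.
    apply/subsetP => g; rewrite inE => /andP[gA /injectivePn[b [c bc e]]].
    (* Position [a] is pinned to [x], so the position to resample is an index of the colliding pair
       other than [a]. *)
    have [ba|ba] := eqVneq b a.
      apply/bigcupP; exists c; first by rewrite -ba eq_sym.
      by rewrite inE gA; apply/existsP; exists b; rewrite bc e eqxx.
    apply/bigcupP; exists b => //.
    by rewrite inE gA; apply/existsP; exists c; rewrite eq_sym bc e eqxx.
  rewrite big_distrr /= (leq_trans (leq_sum _ cE)) // sum_nat_const cardC1 card_ord.
  by rewrite !mulnA.
have : #|A| = #|[set g | independent g && (g a == x)]| +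
              #|[set g in A | ~~ independent g]|.
  rewrite -(cardsID [set g | independent g] A); congr (_ + _).
    by apply: eq_card => g; rewrite !inE andbC.
  by apply: eq_card => g; rewrite !inE andbC.
set X := #|[set g | _ && _]|; set Y := #|[set g in A | _]| in bad *.
move=> eA; rewrite eA in bad *.
have : 2 * (#|U| * Y) <= #|U| * (X + Y).
  apply: (@leq_trans (2 * (s.-1 ^ 2 * m) * (X + Y))).
    by rewrite -mulnA leq_mul2l bad.
  by rewrite leq_mul2r sm orbT.
by rewrite mulnCA leq_pmul2l //; lia.
Qed.

(** A random group covers [x] with probability at least [s / (2 * #|U|)]: the sum over the position
    of [x] of the bounds [1 / (2 * #|U|)]. *)
Lemma card_covers x : s * #|U| ^ s <= 2 * #|U| * #|[set g | covers g x]|.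
Proof.
have c1 (a : 'I_s) : #|U| * #|[set g : {ffun 'I_s -> U} | g a == x]| = #|U| ^ s.
  pose F i : {set U} := if i == a then [set x] else setT.
  transitivity (#|U| * #|[set g : {ffun 'I_s -> U} | [forall i, g i \in F i]]|).
    congr (_ * _); apply: eq_card => g; rewrite !inE; apply/idP/forallP.
      by move=> /eqP gx i; rewrite /F; case: eqP => [->|]; rewrite ?gx inE.
    by move=> /(_ a); rewrite /F eqxx inE.
  rewrite card_ffun_family (bigD1 a) //= /F eqxx cards1 mul1n.
  rewrite (eq_bigr (fun _ => #|U|)); last first.
    by move=> i /negPf->; rewrite cardsT.
  rewrite prod_nat_const cardC1 card_ord -expnS prednK //.
  by apply: leq_ltn_trans (ltn_ord a).
(* An independent [g] is injective, so the events [g a = x] are disjoint in [a]. *)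
have c2 : \sum_(a < s) #|[set g | independent g && (g a == x)]| <=
          #|[set g | covers g x]|.
  rewrite (eq_bigr (fun a => \sum_(g | independent g) (g a == x))); last first.
    move=> a _; rewrite -sum1_card big_mkcond [RHS]big_mkcond /=.
    by apply: eq_bigr => g _; rewrite inE; case: (independent g); case: (g a == x).
  rewrite exchange_big /= -sum1_card big_mkcond [X in _ <= X]big_mkcond /=.
  apply: leq_sum => g _; rewrite inE /covers.
  have [ig|//] := boolP (independent g); rewrite /=.
  have [/codomP[a ex]|nx] := boolP (x \in codom g); last first.
    rewrite big1 // => a _; apply/eqP; rewrite eqb0; apply: contra nx => /eqP <-.
    exact: codom_f.
  rewrite (bigD1 a) //= -ex eqxx big1 ?addn0 // => c ca; apply/eqP.
  rewrite eqb0 ex; apply: contra ca => /eqP e.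
  by apply/eqP; move/injectiveP: ig; apply; rewrite e.
have c3 : s * #|U| ^ s <=
    2 * #|U| * \sum_(a < s) #|[set g | independent g && (g a == x)]|.
  rewrite -[s in s * _]card_ord -sum_nat_const big_distrr /=.
  apply: leq_sum => a _; rewrite -(c1 a) [2 * #|U|]mulnC -[X in _ <= X]mulnA leq_mul2l.
  by rewrite card_independent_at orbT.
by apply: leq_trans c3 _; rewrite leq_mul2l c2 orbT.
Qed.

Definition missed N (f : {ffun 'I_N -> {ffun 'I_s -> U}}) : {set U} :=
  [set x | [forall i, ~~ covers (f i) x]].

(** Every [d] groups at least halve the probability that a given point is missed, so the expected
    number of missed points is at most [#|U| / 2 ^ r]; Markov's inequality follows. *)
Lemma card_missed_gt (d r m' : nat) : 0 < s -> 2 * #|U| <= d * s ->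
  #|[set f : {ffun 'I_(d * r) -> {ffun 'I_s -> U}} | m' < #|missed f| ]|
    * (m'.+1 * 2 ^ r)
  <= #|U| * #|{ffun 'I_(d * r) -> {ffun 'I_s -> U}}|.
Proof.
move=> s0 ds; set N := d * r; set bad := #|_|.
pose G := #|U| ^ s.
have cG : #|{ffun 'I_s -> U}| = G by rewrite card_ffun card_ord.
have one x : #|[set f : {ffun 'I_N -> {ffun 'I_s -> U}} | x \in missed f]|
             * 2 ^ r <= G ^ N.
  have -> : #|[set f : {ffun 'I_N -> {ffun 'I_s -> U}} | x \in missed f]| =
      (G - #|[set g | covers g x]|) ^ N.
    have -> : G - #|[set g | covers g x]| = #|~: [set g | covers g x]|.
      by rewrite -cG [in RHS]cardsCs setCK.
    rewrite -[in RHS](card_ord N) -prod_nat_const -card_ffun_family.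
    apply: eq_card => f; rewrite !inE; apply/forallP/forallP => h i.
      by have := h i; rewrite !inE.
    by have := h i; rewrite !inE.
  set c := #|_|; have U0 : 0 < #|U| by apply/card_gt0P; exists x.
  have h : 2 * (G - c) ^ d <= G ^ d.
    apply: expn_sub_half; first by rewrite expn_gt0 U0.
      by rewrite -cG max_card.
    have := card_covers x; rewrite -/c -/G => h.
    have : 2 * #|U| * G <= 2 * #|U| * (d * c).
      apply: (@leq_trans (d * s * G)); first by rewrite leq_mul2r ds orbT.
      by rewrite [X in _ <= X]mulnCA -[X in X <= _]mulnA leq_mul2l h orbT.
    by rewrite leq_pmul2l // muln_gt0.
  rewrite /N !expnM -expnMn mulnC; case: (r) => [|r'] //.
  by rewrite leq_exp2r.
rewrite card_ffun card_ord cG -/G.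
apply: (@leq_trans (\sum_x #|[set f : {ffun 'I_N -> {ffun 'I_s -> U}} |
                               x \in missed f]| * 2 ^ r)); last first.
  by rewrite -sum_nat_const; apply: leq_sum => x _; exact: one.
rewrite -big_distrl /= mulnA leq_mul2r; apply/orP; right.
rewrite (eq_bigr (fun x => \sum_(f : {ffun 'I_N -> {ffun 'I_s -> U}})
   (x \in missed f))); last first.
  move=> x _; rewrite -sum1_card big_mkcond /=.
  by apply: eq_bigr => f _; rewrite inE; case: (x \in _).
rewrite exchange_big /= /bad -sum_nat_const big_mkcond /=.
apply: leq_sum => f _; rewrite inE; case: ltnP => // h.
by rewrite -big_mkcond /= sum1_card.
Qed.

End RandomGroups.

(** * Random test sets *)

Section RandomTestSets.
Variables (U : finType) (M : nat).
Implicit Types (h : {ffun U -> 'I_M}) (C D : {set U}).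

(** [h] draws a level below [M] for each point; the points of level below [t] form a random set of
    density [t / M], so one [h] serves all densities. *)
Definition avoids (t : nat) D h : bool := [forall u in D, t <= h u].

Lemma card_avoids t D :
  #|[set h | avoids t D h]| = (M - t) ^ #|D| * M ^ (#|U| - #|D|).
Proof.
pose F u : {set 'I_M} := if u \in D then [set v : 'I_M | t <= v] else setT.
transitivity #|[set h : {ffun U -> 'I_M} | [forall u, h u \in F u]]|.
  apply: eq_card => h; rewrite !inE /avoids; apply: eq_forallb => u.
  by rewrite /F; case: (u \in D); rewrite inE.
rewrite card_ffun_family (bigID (mem D)) /=; congr (_ * _).
  rewrite -prod_nat_const; apply: eq_bigr => u uD; rewrite /F uD.
  rewrite -sum1_card (eq_bigl (fun v : 'I_M => true && (t <= v))); last first.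
    by move=> v; rewrite inE.
  by rewrite -(big_geq_mkord t M predT (fun _ => 1)) sum_nat_const_nat muln1.
have -> : #|U| - #|D| = #|~: D| by rewrite [RHS]cardsCs setCK.
rewrite -[M in RHS]card_ord -cardsT -prod_nat_const.
by apply: eq_big => [u|u uD]; rewrite ?inE // /F (negPf uD).
Qed.

(* Only the avoidance probability [q >= 1/2] of [C] matters: whatever the one
   of [C'], independence bounds the probability of agreement by [q]. *)
Lemma card_avoids_agree t (C C' : {set U}) : [disjoint C & C'] ->
  0 < M -> t <= M -> 2 * (#|C| * t) <= M -> M <= 4 * (#|C| * t) ->
  5 * #|[set h | avoids t C h == avoids t C' h]| <= 4 * #|{ffun U -> 'I_M}|.
Proof.
move=> dC M0 tM hl hu; rewrite card_ffun card_ord.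
set same := #|_|; set tot := M ^ _.
set X := #|[set h | avoids t C h]|; set X' := #|[set h | avoids t C' h]|.
set Z := #|[set h | avoids t (C :|: C') h]|.
have cU D : #|D| <= #|U| by exact: max_card.
have caE h : avoids t (C :|: C') h = avoids t C h && avoids t C' h.
  apply/forall_inP/andP => [H|[/forall_inP H /forall_inP H'] u].
    by split; apply/forall_inP => u uC; apply: H; rewrite inE uC ?orbT.
  by rewrite inE => /orP[]; [exact: H | exact: H'].
have Ztot : Z * tot = X * X'.
  rewrite /Z /X /X' !card_avoids cardsU.
  have -> : C :&: C' = set0 by apply: disjoint_setI0.
  rewrite cards0 subn0 /tot.
  have cCC : #|C| + #|C'| <= #|U|.
    by have := cU (C :|: C'); rewrite cardsU disjoint_setI0 // cards0 subn0.
  have -> : #|U| - #|C| = (#|U| - (#|C| + #|C'|)) + #|C'| by lia.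
  have -> : #|U| - #|C'| = (#|U| - (#|C| + #|C'|)) + #|C| by lia.
  have -> : M ^ #|U| = M ^ (#|U| - (#|C| + #|C'|)) * M ^ #|C| * M ^ #|C'|.
    by rewrite -!expnD; congr (_ ^ _); lia.
  by rewrite !expnD; ring.
have sameE : same + X + X' = tot + 2 * Z.
  have totE : tot = \sum_(h : {ffun U -> 'I_M}) 1.
    by rewrite sum1_card card_ffun card_ord.
  have cE (p : pred {ffun U -> 'I_M}) : #|[set h | p h]| = \sum_h (p h : nat).
    rewrite -sum1_card big_mkcond /=; apply: eq_bigr => h _.
    by rewrite inE; case: (p h).
  rewrite totE /same /X /X' /Z !cE big_distrr -!big_split /=.
  apply: eq_bigr => h _; rewrite caE.
  by case: (avoids t C h); case: (avoids t C' h).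
have X'tot : X' <= tot.
  by rewrite (leq_trans (max_card _)) // card_ffun card_ord.
set w := M - t.
have Cgt0 : 0 < #|C| by case: (#|C|) hu; lia.
have e1 : M ^ #|C| <= 2 * w ^ #|C|.
  have b1 := bernoulli_subn #|C| tM; rewrite -/w in b1.
  have b2 : M ^ #|C| * (2 * (#|C| * t)) <= M ^ #|C| * M by rewrite leq_mul2l hl orbT.
  rewrite -(leq_pmul2r M0); nia.
(* For [w > 0], [(M / w) ^ #|C| >= 1 + #|C| * t / w >= 5 / 4], as [w <= M <= 4 * (#|C| * t)]. *)
have e2 : 5 * w ^ #|C| <= 4 * M ^ #|C|.
  have := bernoulli_addn w t #|C|; rewrite subnK // => b1.
  have [w0|w0] := posnP w; first by rewrite w0 exp0n.
  have b2 : w ^ #|C| * (5 * w) <= w ^ #|C| * (4 * (w + #|C| * t)).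
    by rewrite leq_mul2l; apply/orP; right; lia.
  rewrite -(leq_pmul2l w0); nia.
have Mtot : tot = M ^ #|C| * M ^ (#|U| - #|C|).
  by rewrite -expnD subnKC.
have XE : X = w ^ #|C| * M ^ (#|U| - #|C|) by rewrite /X card_avoids.
have tot2X : tot <= 2 * X.
  by rewrite Mtot XE mulnA leq_mul2r e1 orbT.
have X4tot : 5 * X <= 4 * tot.
  by rewrite Mtot XE !mulnA leq_mul2r e2 orbT.
have tot0 : 0 < tot by rewrite expn_gt0 M0.
(* With [q'] the avoidance probability of [C'], agreement has probability
   [(1 - q) + q' * (2 * q - 1)], at most [q] because [q' <= 1] and [q >= 1/2]. *)
suff : same <= X by lia.
rewrite -(leq_pmul2l tot0).
have : X' * (2 * X - tot) <= tot * (2 * X - tot) by rewrite leq_mul2r X'tot orbT.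
have : tot * (same + X + X') = tot * tot + 2 * (X * X').
  by rewrite sameE -Ztot; ring.
move: tot2X X'tot; clear.
move: tot X X' same => tot X X' same.
by rewrite !mulnBr => *; nia.
Qed.

Definition test_sets (L I : nat) (H : {ffun 'I_L -> {ffun U -> 'I_M}}) :
  seq {set U} :=
  [seq [set u | H l u < 2 ^ i] | l <- enum 'I_L, i <- iota 0 I].

Lemma size_test_sets L I H : size (@test_sets L I H) = L * I.
Proof. by rewrite size_allpairs size_enum_ord size_iota. Qed.

(** Union bound over at most [#|P| ^ 2] ordered pairs of clusters. For one pair, the threshold
    suited to the first cluster alone fails with probability at most 4/5 per hash. *)
Lemma card_unseparated (L I : nat) (P : {set {set U}}) :
  partition P [set: U] -> 0 < M ->
  (forall C, C \in P -> exists2 i, i < I &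
     2 * (#|C| * 2 ^ i) <= M <= 4 * (#|C| * 2 ^ i)) ->
  #|[set H | ~~ separated (@test_sets L I H) P]| * 5 ^ L <=
  #|P| ^ 2 * (4 ^ L * #|{ffun 'I_L -> {ffun U -> 'I_M}}|).
Proof.
move=> pP M0 scale.
pose F (p : {set U} * {set U}) := [set H : {ffun 'I_L -> {ffun U -> 'I_M}} |
  [forall l, forall i : 'I_I,
     avoids (2 ^ i) p.1 (H l) == avoids (2 ^ i) p.2 (H l)]].
have cover_bad : [set H | ~~ separated (@test_sets L I H) P] \subset
    \bigcup_(p in setX P P :\: [set p | p.1 == p.2]) F p.
  apply/subsetP => H; rewrite inE => /forallPn[x /forallPn[y]].
  rewrite negb_imply => /andP[/eqP sxy nxy].
  have /and3P[/eqP cP _ _] := pP.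
  have pm z : pblock P z \in P by rewrite pblock_mem // cP inE.
  apply/bigcupP; exists (pblock P x, pblock P y); first by rewrite !inE nxy !pm.
  rewrite inE; apply/forallP => l; apply/forallP => i; apply/eqP => /=.
  have aE z : avoids (2 ^ i) (pblock P z) (H l) =
      (pblock P z :&: [set u | H l u < 2 ^ i] == set0).
    apply/forall_inP/eqP => [A|A u uz].
      by apply/setP => u; rewrite !inE; apply/andP => [[/A]]; rewrite leqNgt => /negP.
    rewrite leqNgt; apply/negP => hu.
    by have : u \in set0; [rewrite -A !inE uz | rewrite inE].
  rewrite !aE; move/eq_in_map: sxy; apply.
  by apply/allpairsP; exists (l, val i); rewrite mem_enum mem_iota /= ltn_ord.
have one p : p \in setX P P :\: [set p | p.1 == p.2] ->
    #|F p| * 5 ^ L <= 4 ^ L * #|{ffun 'I_L -> {ffun U -> 'I_M}}|.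
  case: p => C C'; rewrite !inE /= => /and3P[CC CP CP'].
  have [i iI /andP[hl hu]] := scale C CP.
  pose S := [set h | avoids (2 ^ i) C h == avoids (2 ^ i) C' h].
  have hS : 5 * #|S| <= 4 * #|{ffun U -> 'I_M}|.
    apply: card_avoids_agree => //.
      by have /and3P[_ /trivIsetP tiP _] := pP; apply: tiP.
    have : 0 < #|C|.
      rewrite card_gt0; apply: contraTneq CP => ->.
      by have /and3P[_ _] := pP.
    by nia.
  have sF : #|F (C, C')| <= #|S| ^ L.
    rewrite -[in X in _ <= X](card_ord L) -prod_nat_const -card_ffun_family.
    apply: subset_leq_card; apply/subsetP => H; rewrite !inE => /forallP A.
    by apply/forallP => l; rewrite inE; have /forallP/(_ (Ordinal iI)) := A l.
  rewrite [#|{ffun _ -> {ffun _ -> _}}|]card_ffun card_ord -expnMn.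
  apply: (@leq_trans (#|S| ^ L * 5 ^ L)); first by rewrite leq_mul2r sF orbT.
  by rewrite -expnMn mulnC; case: (L) => [//|L']; rewrite leq_exp2r.
apply: leq_trans
  (_ : (\sum_(p in setX P P :\: [set p | p.1 == p.2]) #|F p|) * 5 ^ L <= _).
  rewrite leq_mul2r (leq_trans (subset_leq_card cover_bad)) ?orbT //.
  exact: leq_card_bigcup.
rewrite big_distrl /=; apply: leq_trans (leq_sum _ one) _.
rewrite sum_nat_const leq_mul2r; apply/orP; right.
by rewrite (leq_trans (subset_leq_card (subsetDl _ _))) // cardsX mulnn.
Qed.

End RandomTestSets.

(** * The sampled algorithm *)

Section SampledAlgorithm.
Variables (R : realType) (U : finType) (N j L I M m : nat).
Local Notation s := (weighing_capacity j).
Local Notation samples := {ffun 'I_N -> {ffun 'I_s -> U}}.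
Local Notation hashes := {ffun 'I_L -> {ffun U -> 'I_M}}.
Local Notation seeds := (samples * hashes)%type.

Definition sampled_groups (f : samples) : seq (seq U) :=
  [seq codom (f i) | i <- enum 'I_N].

Definition sampled_run (w : seeds) : two_round_alg U :=
  cluster_alg (sampled_groups w.1) (test_sets I w.2) j m.

Lemma uncovered_sampled P (f : samples) :
  uncovered [seq g <- sampled_groups f | uniq (map (pblock P) g)] =
  missed (pblock P) f.
Proof.
apply/setP => x; rewrite !inE all_filter all_map.
have cE i : uniq (map (pblock P) (codom (f i))) = independent (pblock P) (f i).
  by rewrite -map_comp.
apply/allP/forallP => [h i|h i _] /=.
  by have := h i (mem_enum _ i); rewrite /= cE /covers negb_and implybE.
by have := h i; rewrite cE /covers negb_and implybE.
Qed.

Lemma sampled_run_correct P (w : seeds) : partition P [set: U] ->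
  #|missed (pblock P) w.1| <= m -> separated (test_sets I w.2) P ->
  result (sampled_run w) P = P.
Proof.
move=> pP hm sP; apply: cluster_alg_correct => //.
  by move=> g /mapP[i _ ->]; rewrite size_codom card_ord.
by rewrite uncovered_sampled.
Qed.

Lemma sampled_run_num_queries P (w : seeds) :
  num_queries (sampled_run w) P <=
  N + L * I * (1 + m + N * (2 ^ j.+1).-1).
Proof.
apply: leq_trans (cluster_alg_num_queries _ _ _ _ _) _.
by rewrite size_test_sets size_map size_enum_ord.
Qed.

Local Open Scope ring_scope.
Hypothesis seeds_gt0 : (0 < #|{: seeds}|)%N.

Lemma uniform_ge0 (w : seeds) : 0 <= #|{: seeds}|%:R^-1 :> R.
Proof. by rewrite invr_ge0. Qed.

Lemma uniform_sum1 : \sum_(w : seeds) #|{: seeds}|%:R^-1 = 1 :> R.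
Proof.
by rewrite sumr_const -[_ *+ _]mulr_natr mulVf // pnatr_eq0 -lt0n.
Qed.

Definition sampled_alg : rand_two_round_alg R U :=
  RandTwoRoundAlg uniform_ge0 uniform_sum1 sampled_run.

(** Union bound over two failures, each allotted [delta / 2]: too many missed points, or unseparated
    clusters. *)
Lemma sampled_alg_success P (delta : R) : partition P [set: U] ->
  2 * #|[set f : samples | m < #|missed (pblock P) f| ]%N|%:R <=
    delta * #|{: samples}|%:R ->
  2 * #|[set H : hashes | ~~ separated (test_sets I H) P]|%:R <=
    delta * #|{: hashes}|%:R ->
  1 - delta <= success_prob sampled_alg P.
Proof.
move=> pP h1 h2.
have -> : success_prob sampled_alg P =
    1 - #|[set w : seeds | result (sampled_run w) P != P]|%:R / #|{: seeds}|%:R.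
  apply/eqP; rewrite eq_sym subr_eq; apply/eqP.
  rewrite -[LHS]uniform_sum1 (bigID (fun w => result (sampled_run w) P == P)).
  by congr (_ + _); rewrite sumr_const cardsE -[LHS]mulr_natr mulrC.
rewrite lerD2l lerN2 ler_pdivrMr ?ltr0n //.
set b1 := [set f | _] in h1; set b2 := [set H | _] in h2.
have : (#|[set w : seeds | result (sampled_run w) P != P]| <=
        #|b1| * #|{: hashes}| + #|{: samples}| * #|b2|)%N.
  rewrite -!cardsT -!cardsX; apply: leq_trans (leq_card_setU _ _).
  apply: subset_leq_card; apply/subsetP => -[f H]; rewrite !inE /= !andbT.
  apply: contraNT; rewrite negb_or -leqNgt negbK => /andP[hm hs].
  by apply/eqP; apply: sampled_run_correct.
rewrite -(ler_nat R) => /le_trans; apply.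
rewrite natrD !natrM card_prod natrM.
have s1 : 0 <= #|{: samples}|%:R :> R by [].
have s2 : 0 <= #|{: hashes}|%:R :> R by [].
move: h1 h2 s1 s2; move: (#|b1|%:R : R) (#|b2|%:R : R) (#|{: samples}|%:R : R)
  (#|{: hashes}|%:R : R) => x y X Y h1 h2 X0 Y0.
have := ler_wpM2r Y0 h1; have := ler_wpM2l X0 h2; lra.
Qed.

End SampledAlgorithm.

(** * Thresholds matched to the cluster sizes *)

Section Scales.
Local Open Scope ring_scope.
Variables (R : realType) (U : finType) (k : nat) (B : R).
Hypotheses (k0 : (0 < k)%N) (U0 : (0 < #|U|)%N) (B1 : 1 <= B).

Implicit Types (P : {set {set U}}) (C : {set U}).

Definition max_cluster : nat := Num.truncn (B * #|U|%:R / k%:R).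

Lemma balanced_card_le P C : balanced_clustering k B P -> C \in P ->
  (#|C| <= max_cluster)%N.
Proof.
case=> _ _ bP CP; have [_ h] := bP C CP.
by rewrite /max_cluster truncn_ge_nat // (le_trans _ h).
Qed.

Lemma balanced_card_gt0 P C : balanced_clustering k B P -> C \in P ->
  (0 < #|C|)%N.
Proof.
case=> /and3P[_ _ P0] _ _ CP; rewrite card_gt0.
by apply: contraTneq CP => ->.
Qed.

Lemma max_cluster_le : max_cluster%:R <= B * #|U|%:R / k%:R :> R.
Proof.
by rewrite /max_cluster truncn_le divr_ge0 ?mulr_ge0 // (le_trans _ B1).
Qed.

(** Round [#|C|] and [max_cluster] up to powers [2 ^ e] and [2 ^ E]; the threshold is [i = E - e].
    Balancedness gives [2 ^ i <= 2 * B ^ 2 < 2 ^ (2 * b + 3)]. *)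
Lemma balanced_scale (b : nat) P C : B < 2 ^+ b.+1 ->
  balanced_clustering k B P -> C \in P ->
  exists2 i, (i < 2 * b + 3)%N &
   (2 * (#|C| * 2 ^ i) <= 2 ^ (up_log 2 max_cluster).+1 <= 4 * (#|C| * 2 ^ i))%N.
Proof.
move=> Bb bP CP.
have C0 := balanced_card_gt0 bP CP; have Cm := balanced_card_le bP CP.
have m0 : (0 < max_cluster)%N := leq_trans C0 Cm.
have upS a : (0 < a -> 2 ^ up_log 2 a <= 2 * a)%N.
  case: a => [//|[|a]] _; first by rewrite up_log1.
  have := @up_log_gtn 2 a.+2 isT isT.
  have := up_log_gt0 2 a.+2; case: (up_log 2 a.+2) => [//|e] _ /=.
  by rewrite expnS; lia.
set e := up_log 2 #|C|; set E := up_log 2 max_cluster.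
have eE : (e <= E)%N by exact: leq_up_log.
have eC : (#|C| <= 2 ^ e)%N by exact: up_logP.
have eC2 : (2 ^ e <= 2 * #|C|)%N by exact: upS.
have EE : (2 ^ E = 2 ^ e * 2 ^ (E - e))%N by rewrite -expnD subnKC.
exists (E - e)%N; last by rewrite expnS EE; apply/andP; split; nia.
have h : (2 ^ (E - e) * #|C| <= 2 * max_cluster)%N.
  by apply: leq_trans (upS _ m0); rewrite -/E EE mulnC leq_mul2r eC orbT.
rewrite -(@ltn_exp2l 2) // -(ltr_nat R).
have hR : (2 ^ (E - e))%:R * #|C|%:R <= 2 * (B * #|U|%:R / k%:R) :> R.
  rewrite -natrM; apply: le_trans (_ : (2 * max_cluster)%:R <= _).
    by rewrite ler_nat.
  by rewrite natrM ler_pM2l // max_cluster_le.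
have [_ _ /(_ C CP)[hC _]] := bP.
have k0R : 0 < k%:R :> R by rewrite ltr0n.
have U0R : 0 < #|U|%:R :> R by rewrite ltr0n.
have B0 : 0 < B by exact: lt_le_trans B1.
have {}hR : (2 ^ (E - e))%:R <= 2 * B ^+ 2 :> R.
  have : (2 ^ (E - e))%:R * (#|U|%:R / (B * k%:R)) <= 2 * (B * #|U|%:R / k%:R) :> R.
    by apply: le_trans hR; rewrite ler_wpM2l.
  move=> h'; rewrite -(@ler_pM2r _ (#|U|%:R / (B * k%:R))) ?divr_gt0 ?mulr_gt0 //.
  apply: (le_trans h'); rewrite le_eqVlt; apply/orP; left; apply/eqP.
  by field; rewrite !gt_eqF.
apply: le_lt_trans hR _.
have -> : (2 ^ (2 * b + 3))%:R = 2 * (2 ^+ b.+1) ^+ 2 :> R.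
  by rewrite natrX -exprM -exprS; congr (_ ^+ _); lia.
by rewrite ltr_pM2l // ltr_pXn2r // nnegrE ?exprn_ge0 // ltW.
Qed.

End Scales.

Section Recovery.
Local Open Scope ring_scope.
Variables (R : realType) (U : finType) (k : nat) (B delta : R).
Hypotheses (k0 : (0 < k)%N) (U0 : (0 < #|U|)%N) (B1 : 1 <= B).

Lemma exists_recovering_alg (N j l b m : nat) (q : R) :
  B < 2 ^+ b.+1 ->
  2 * k%:R ^+ 2 <= delta * 2 ^+ l ->
  (forall P, balanced_clustering k B P ->
    2 * #|[set f : {ffun 'I_N -> {ffun 'I_(weighing_capacity j) -> U}} |
             m < #|missed (pblock P) f| ]%N|%:R <=
    delta * #|{ffun 'I_N -> {ffun 'I_(weighing_capacity j) -> U}}|%:R) ->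
  (N + 4 * l * (2 * b + 3) * (1 + m + N * (2 ^ j.+1).-1))%:R <= q ->
  exists A : rand_two_round_alg R U, recovers_balanced A k B delta q.
Proof.
move=> Bb hl hN hq.
pose M := (2 ^ (up_log 2 (max_cluster U k B)).+1)%N.
have M0 : (0 < M)%N by rewrite expn_gt0.
have S0 : (0 < #|{: {ffun 'I_N -> {ffun 'I_(weighing_capacity j) -> U}} *
                 {ffun 'I_(4 * l) -> {ffun U -> 'I_M}}}|)%N.
  by rewrite card_prod !card_ffun !card_ord muln_gt0 !expn_gt0 U0 ?M0.
exists (sampled_alg R (2 * b + 3) m S0) => P bP; split; last first.
  by move=> w; apply: le_trans hq; rewrite ler_nat; apply: sampled_run_num_queries.
have [pP cP _] := bP.
apply: sampled_alg_success => //; first exact: hN.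
have := card_unseparated (4 * l) pP M0 (fun C => balanced_scale k0 U0 B1 Bb bP).
rewrite cP; set X := #|_|; set Y := #|_| => h.
have h2 : (X * 2 ^ l <= k ^ 2 * Y)%N.
  have g : (0 < 4 ^ (4 * l))%N by rewrite expn_gt0.
  rewrite -(leq_pmul2l g) [X in (_ <= X)%N]mulnCA; apply: leq_trans h.
  rewrite mulnCA leq_mul2l; apply/orP; right.
  (* [5 ^ 4 = 625 >= 512 = 2 * 4 ^ 4]: four hashes halve the failure bound. *)
  by rewrite !expnM -expnMn; case: (l) => [//|l']; rewrite leq_exp2r.
have h3 : (X%:R * 2 ^+ l : R) <= k%:R ^+ 2 * Y%:R.
  by rewrite -!natrX -!natrM ler_nat.
have l0 : 0 < 2 ^+ l :> R by rewrite exprn_gt0.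
have Y0 : 0 <= Y%:R :> R by [].
have h4 := ler_wpM2r Y0 hl.
rewrite -(ler_pM2r l0); lra.
Qed.
End Recovery.

(** * Numerical bounds and the degenerate regime *)

(** There are O((b + 1)^2 (j + 1)) test sets, each with O(n r / (j + 1)) probes thanks to coin
    weighing; the factors [j + 1] cancel. Here [228 = 4 * 19 * 3] is the case [b = j = 0], and
    [3195 = 228 * 14 + 3]. *)
Lemma budget_le (n b j r : nat) : 0 < r -> j < n -> weighing_capacity j <= n ->
  let N := (2 * n %/ weighing_capacity j).+1 * r in
  N + 4 * (3 * b + 12 * j + 19) * (2 * b + 3) *
        (1 + n %/ j.+1 + N * (2 ^ j.+1).-1) <=
  3195 * (b.+1 ^ 2 * (n * r)).
Proof.
move=> r0 jn sn; set s := weighing_capacity j; set d := _.+1.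
have s0 : 0 < s by exact: weighing_capacity_gt0.
have ds : d * s <= 3 * n.
  by rewrite mulSn; have := leq_trunc_div (2 * n) s; lia.
have d3 : d <= 3 * n by apply: leq_trans ds; rewrite leq_pmulr.
set q := (2 ^ j.+1).-1; set m := n %/ j.+1.
have mj : m * j.+1 <= n by exact: leq_trunc_div.
have dq : d * q * j.+1 <= 12 * n.
  have h := weighing_capacity_ge j.
  have h1 : q * j.+1 <= 4 * s.
    by move: h; rewrite /q /s expnS; have := expn_gt0 2 j; nia.
  apply: (@leq_trans (4 * (d * s))); last by lia.
  by rewrite -mulnA [4 * _]mulnCA leq_mul2l h1 orbT.
have tot : (1 + m + d * r * q) * j.+1 <= 14 * (n * r).
  have : d * q * j.+1 * r <= 12 * n * r by rewrite leq_mul2r dq orbT.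
  have : n <= n * r by rewrite leq_pmulr.
  have -> : (1 + m + d * r * q) * j.+1 = j.+1 + m * j.+1 + d * q * j.+1 * r by ring.
  by clear -jn mj; lia.
have c1 : 4 * (3 * b + 12 * j + 19) * (2 * b + 3) <= 228 * (b.+1 ^ 2 * j.+1).
  by rewrite -!mulnn; nia.
have c2 : 4 * (3 * b + 12 * j + 19) * (2 * b + 3) * (1 + m + d * r * q) <=
          3192 * (b.+1 ^ 2 * (n * r)).
  apply: leq_trans (leq_mul c1 (leqnn _)) _.
  have := leq_mul (leqnn (228 * b.+1 ^ 2)) tot.
  have -> : 228 * b.+1 ^ 2 * (14 * (n * r)) = 3192 * (b.+1 ^ 2 * (n * r)) by lia.
  by apply: leq_trans; rewrite leq_eqVlt; apply/orP; left; apply/eqP; ring.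
have c3 : d * r <= 3 * (b.+1 ^ 2 * (n * r)).
  have : n * r <= b.+1 ^ 2 * (n * r) by rewrite leq_pmull // expn_gt0.
  have : d * r <= 3 * n * r by rewrite leq_mul2r d3 orbT.
  lia.
by apply: leq_trans (leq_add c3 c2) _; rewrite -mulnDl leq_mul2r orbT.
Qed.

Lemma scales_le b : 2 * b + 3 <= 3 * b.+1 ^ 2.
Proof. by rewrite -mulnn; nia. Qed.

Lemma expn4_le_exp2 b : b.+1 ^ 4 <= 64 * 2 ^ b.
Proof.
have [|b6] := leqP b 6; first by do 7 (case: b => [//|b]).
rewrite -(subnK b6); elim: (b - 7) => [//|i IH].
rewrite !addSn [2 ^ _]expnS mulnCA; apply: leq_trans (leq_mul (leqnn 2) IH).
by rewrite -addnS; move: (i + 7) (leq_addl i 7) => c c7; nia.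
Qed.

Local Open Scope ring_scope.

(** * Logarithms and powers of two *)

Section RealBounds.
Variable R : realType.
Implicit Types x y : R.

Lemma ln_le_subr1 x : 0 < x -> ln x <= x - 1.
Proof.
by move=> x0; have := @le_ln1Dx R (x - 1); rewrite addrCA subrr addr0; apply; lra.
Qed.

Lemma ln2_ge : 2^-1 <= ln 2 :> R.
Proof.
have : ln (2^-1) <= 2^-1 - 1 :> R by apply: ln_le_subr1; lra.
by rewrite lnV ?posrE //; lra.
Qed.

Lemma ln2_le1 : ln 2 <= 1 :> R.
Proof. by have := @ln_le_subr1 2; lra. Qed.

(** Compare with [(7 / 6) ^ 7 < 3]. It makes [ln (ln k)] bounded below by a positive constant for
    [k >= 3]. *)
Lemma ln3_gt1 : 1 < ln 3 :> R.
Proof.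
have h : 7^-1 <= ln (7 / 6) :> R.
  have : ln (6 / 7) <= 6 / 7 - 1 :> R by apply: ln_le_subr1; lra.
  by rewrite -[6 / 7]invf_div lnV ?posrE; lra.
have : ln ((7 / 6) ^+ 7) < ln 3 :> R.
  by rewrite ltr_ln ?posrE ?exprn_gt0 //; lra.
by rewrite lnXn //; lra.
Qed.

Lemma exp_bracket (p : nat) x : (1 < p)%N -> 1 <= x ->
  exists t, p%:R ^+ t <= x < p%:R ^+ t.+1.
Proof.
move=> p1 x1; exists (trunc_log p (Num.truncn x)).
have x0 : 0 <= x by apply: le_trans x1.
have t0 : (0 < Num.truncn x)%N by rewrite truncn_gt0.
rewrite -!natrX; apply/andP; split.
  by rewrite -truncn_ge_nat // trunc_logP.
by rewrite -truncn_lt_nat // trunc_log_ltn.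
Qed.

Lemma exists_exp2_ge x : 1 <= x ->
  exists l, [/\ (0 < l)%N, x <= 2 ^+ l & l%:R <= 1 + 2 * ln x].
Proof.
move=> x1; have [t /andP[h1 h2]] := exp_bracket (isT : 1 < 2)%N x1.
exists t.+1; split=> //; first exact: ltW.
have : ln (2 ^+ t) <= ln x by rewrite ler_ln ?posrE ?exprn_gt0 //; lra.
rewrite lnXn // -[_ *+ t]mulr_natr -natr1 => h.
have := ler_wpM2r (ler0n R t) ln2_ge; lra.
Qed.

(** The source of the factor [sqrt B]: the construction costs only a factor (1 + log B)^2, which is
    absorbed here. *)
Lemma sqr_exponent_le (b : nat) (B : R) : 2 ^+ b <= B ->
  b.+1%:R ^+ 2 <= 8 * Num.sqrt B.
Proof.
move=> bB; have B0 : 0 <= B by apply: le_trans bB; rewrite exprn_ge0.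
rewrite -(@ler_pXn2r _ 2) // ?nnegrE ?exprn_ge0 ?mulr_ge0 ?sqrtr_ge0 //.
rewrite [X in _ <= X]exprMn sqr_sqrtr // -exprM.
have := expn4_le_exp2 b; rewrite -(ler_nat R) natrM !natrX; lra.
Qed.

End RealBounds.

Section TrivialRegime.
Variables (R : realType) (U : finType) (k : nat) (B delta q : R).

Lemma unit_prob_sum1 : \sum_(w : unit) (1 : R) = 1.
Proof. by rewrite sumr_const card_unit. Qed.

Definition constant_alg : rand_two_round_alg R U :=
  RandTwoRoundAlg (fun _ : unit => ler01) unit_prob_sum1
    (fun _ => TwoRoundAlg [::] (fun _ => [::])
                (fun _ _ => if k == 1%N then [set [set: U]] else set0)).

Lemma card_partition_le (P : {set {set U}}) :
  partition P [set: U] -> (#|P| <= #|U|)%N.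
Proof.
move=> pP; rewrite -cardsT (card_partition pP) -sum1_card.
apply: leq_sum => C CP; rewrite card_gt0; apply: contraTneq CP => ->.
by have /and3P[] := pP.
Qed.

(** Success is vacuous for [delta >= 1], no clustering exists for [k > #|U|], and [k <= 1]
    determines it. *)
Lemma constant_alg_recovers : 0 < delta -> 0 <= q ->
  [|| 1 <= delta, (k <= 1)%N | (#|U| < k)%N] ->
  recovers_balanced constant_alg k B delta q.
Proof.
move=> d0 q0 hk P [pP cP _]; split; last by move=> w.
have [d1|d1] := leP 1 delta.
  by rewrite (@le_trans _ _ 0) ?subr_le0 // /success_prob sumr_ge0.
suff eP : (if k == 1%N then [set [set: U]] else set0) = P.
  rewrite /success_prob /= (eq_bigl predT); last by move=> w; rewrite /result /= eP eqxx.
  by rewrite unit_prob_sum1 lerBlDr lerDl ltW.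
move: hk; rewrite leNgt d1 /= -cP => /orP[|]; last first.
  by rewrite ltnNge card_partition_le.
rewrite leq_eqVlt ltnS leqn0 => /orP[/eqP P1|].
  rewrite P1 eqxx; have /eqP/cards1P[C eC] := P1.
  have /and3P[/eqP] := pP.
  by rewrite eC /cover big_set1 => ->.
by move=> c0; rewrite (eqP c0) /=; apply/esym/eqP; rewrite -cards_eq0.
Qed.

End TrivialRegime.

(** * Choice of the parameters *)

Section Regimes.
Variables (R : realType) (U : finType) (k : nat) (B delta : R).
Hypotheses (k2 : (2 <= k)%N) (kU : (k <= #|U|)%N) (B1 : 1 <= B).
Hypotheses (delta0 : 0 < delta) (delta1 : delta < 1).

Local Notation mu := (Num.max 1 (ln (ln k%:R / delta))).

Let k_gt0 : (0 < k)%N. Proof. exact: leq_trans k2. Qed.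
Let U_gt0 : (0 < #|U|)%N. Proof. exact: leq_trans k_gt0 kU. Qed.

Lemma lnk_ge : 2^-1 <= ln k%:R :> R.
Proof.
apply: le_trans (ln2_ge R) _.
by rewrite ler_ln ?posrE ?ltr0n ?k_gt0 // ler_nat.
Qed.

Let mu_ge1 : 1 <= mu. Proof. by rewrite le_max lexx. Qed.

Lemma ln_le_mu (c : nat) (x : R) : 0 < x -> x <= 2 ^+ c * (ln k%:R / delta) ->
  ln x <= c%:R + mu.
Proof.
move=> x0 hx; have lk := lnk_ge.
have y0 : 0 < ln k%:R / delta by rewrite divr_gt0 //; lra.
have : ln x <= ln (2 ^+ c * (ln k%:R / delta)).
  by rewrite ler_ln ?posrE // mulr_gt0 // exprn_gt0.
rewrite lnM ?posrE ?exprn_gt0 // lnXn // -[ln 2 *+ c]mulr_natr => h.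
have h1 : ln (ln k%:R / delta) <= mu by rewrite le_max lexx orbT.
have := ler_wpM2r (ler0n R c) (ln2_le1 R); lra.
Qed.

(** For [delta <= 1 / k] the logarithm of [k ^ 2 / delta] is already O(mu), so a singleton probe for
    each point and test set is affordable. *)
Lemma exists_alg_small_delta : delta * k%:R <= 1 ->
  exists A : rand_two_round_alg R U,
    recovers_balanced A k B delta (2 * 10 ^+ 5 * (Num.sqrt B * #|U|%:R * mu)).
Proof.
move=> dk; have [b /andP[b1 b2]] := exp_bracket (isT : 1 < 2)%N B1.
have k2R : 2 <= k%:R :> R by rewrite ler_nat.
have id1 : 1 <= delta^-1 by rewrite invf_ge1 // ltW.
have kd : k%:R <= delta^-1 by rewrite -[delta^-1]mul1r ler_pdivlMr // mulrC.
have x1 : 1 <= 2 * k%:R ^+ 2 / delta.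
  apply: le_trans id1 _; rewrite ler_pMl ?invr_gt0 //.
  have : 2 ^+ 2 <= k%:R ^+ 2 :> R by rewrite lerXn2r ?nnegrE.
  lra.
have [l [_ l1 l2]] := exists_exp2_ge x1.
have hl : l%:R <= 15 * mu.
  have h1 : ln (delta^-1) <= 1%:R + mu.
    apply: ln_le_mu; first by rewrite invr_gt0.
    rewrite expr1 mulrA ler_peMl ?invr_ge0 ?(ltW delta0) //.
    by have := lnk_ge; lra.
  have h2 : ln (2 * k%:R ^+ 2 / delta) <= 1 + 3 * ln (delta^-1).
    apply: le_trans (_ : ln (2 * (delta^-1) ^+ 3) <= _).
      rewrite ler_ln ?posrE ?divr_gt0 ?mulr_gt0 ?exprn_gt0 ?invr_gt0 ?ltr0n ?k_gt0 //.
      rewrite (exprSr _ 2) mulrA ler_pM2r ?invr_gt0 // ler_pM2l //.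
      by rewrite lerXn2r ?nnegrE ?invr_ge0 // ltW.
    rewrite lnM ?posrE ?exprn_gt0 ?invr_gt0 // lnXn ?invr_gt0 //.
    by have := ln2_le1 R; rewrite -[ln _ *+ 3]mulr_natr; lra.
  by have := mu_ge1; lra.
(* [N = 0] means no groups; with [m = #|U|] the second batch is never withheld. *)
apply: (@exists_recovering_alg _ _ _ _ _ k_gt0 U_gt0 B1 0 0 l b #|U|) => //.
- by move: l1; rewrite ler_pdivrMr // [_ * delta]mulrC.
- move=> P bP; rewrite [#|[set _ | _]|]eq_card0 ?mulr0 ?mulr_ge0 ?(ltW delta0) //.
  by move=> f; rewrite !inE ltnNge max_card.
rewrite mul0n addn0 add0n !natrM [(1 + _)%:R]natrD.
have hb : (2 * b + 3)%:R <= 24 * Num.sqrt B :> R.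
  apply: le_trans (_ : 3 * (b.+1%:R ^+ 2) <= _).
    by rewrite -natrX -natrM ler_nat scales_le.
  by have := sqr_exponent_le b1; lra.
have U1 : 1 <= #|U|%:R :> R by rewrite ler1n U_gt0.
have e1 : 4%:R * l%:R * (2 * b + 3)%:R <= 4 * (15 * mu) * (24 * Num.sqrt B) :> R.
  by rewrite ler_pM ?mulr_ge0 // ler_pM2l.
have e2 : 1%:R + #|U|%:R <= 2 * #|U|%:R :> R by lra.
apply: le_trans (ler_pM _ _ e1 e2) _; rewrite ?mulr_ge0 ?addr_ge0 //.
have : 0 <= Num.sqrt B * #|U|%:R * mu.
  by rewrite !mulr_ge0 ?sqrtr_ge0 // (le_trans _ mu_ge1).
lra.
Qed.

(** [2 * B * 16 ^ j <= k] is the birthday condition for groups of at most [4 ^ j] points; maximality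
    of [j] bounds [log k] by O(1 + log B + j), and [2 ^ j.+1 <= k] gives [j + 1 = O(ln k)]. *)
Lemma exists_group_exponent : exists j : nat,
  [/\ k%:R < 2 * B * 16 ^+ j.+1, (j == 0)%N || (2 * B * 16 ^+ j <= k%:R) &
      (2 ^ j.+1 <= k)%N].
Proof.
have B0 : 0 < 2 * B by rewrite mulr_gt0 // (lt_le_trans _ B1).
have [h|h] := leP (2 * B) k%:R; last first.
  by exists 0%N; split=> //; rewrite expr1; move: h; lra.
have [|j /andP[j1 j2]] := @exp_bracket R 16 (k%:R / (2 * B)) isT.
  by rewrite ler_pdivlMr // mul1r.
exists j; split; first by rewrite mulrC -ltr_pdivrMr.
  by rewrite mulrC -ler_pdivlMr // j1 orbT.
rewrite -(ler_nat R) natrX exprS.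
move: j1; rewrite ler_pdivlMr // => j1; apply: le_trans j1.
rewrite mulrC ler_pM ?exprn_ge0 //; last by have := B1; lra.
by rewrite lerXn2r ?nnegrE //; lra.
Qed.

Lemma exists_alg_large_delta : 1 <= delta * k%:R ->
  exists A : rand_two_round_alg R U,
    recovers_balanced A k B delta (2 * 10 ^+ 5 * (Num.sqrt B * #|U|%:R * mu)).
Proof.
move=> dk; have [b /andP[b1 b2]] := exp_bracket (isT : 1 < 2)%N B1.
have [j [kj jk jk2]] := exists_group_exponent.
have k0R : 0 < k%:R :> R by rewrite ltr0n k_gt0.
have B0 : 0 < B by exact: lt_le_trans B1.
have U0R : 0 < #|U|%:R :> R by rewrite ltr0n U_gt0.
have x1 : 1 <= 2 * j.+1%:R / delta.
  rewrite ler_pdivlMr // mul1r; have : 1 <= j.+1%:R :> R by rewrite ler1n.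
  by have := delta1; lra.
(* [2 ^ r >= 2 * (j + 1) / delta] is what Markov needs when at most [#|U| / (j + 1)] points may stay
   uncovered. *)
have [r [r0 r1 r2]] := exists_exp2_ge x1.
have hr : r%:R <= 7 * mu.
  have : ln (2 * j.+1%:R / delta) <= 2%:R + mu.
    apply: ln_le_mu; first by apply: lt_le_trans x1.
    rewrite mulrA ler_pM2r ?invr_gt0 //.
    have : ln (2 ^+ j.+1) <= ln k%:R :> R.
      by rewrite ler_ln ?posrE ?exprn_gt0 // -natrX ler_nat.
    rewrite lnXn // -[ln 2 *+ _]mulr_natr => h.
    have := ler_wpM2r (ler0n R j.+1) (ln2_ge R).
    by rewrite expr2; lra.
  by have := mu_ge1; lra.
pose s := weighing_capacity j.
have s0 : (0 < s)%N by exact: weighing_capacity_gt0.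
have sU : (s <= #|U|)%N.
  case/orP: jk => [/eqP j0|jk].
    by rewrite /s j0 /= U_gt0.
  apply: leq_trans (weighing_capacity_le j) _; apply: leq_trans kU.
  rewrite -(ler_nat R) natrX; apply: le_trans jk.
  have : 4 ^+ j <= 16 ^+ j :> R by rewrite lerXn2r ?nnegrE //; lra.
  have : 0 < 16 ^+ j :> R by rewrite exprn_gt0.
  have := B1; nra.
have jU : (j < #|U|)%N.
  by apply: leq_trans kU; apply: leq_trans jk2; apply: ltnW; apply: ltn_expl.
pose d := (2 * #|U| %/ s).+1.
apply: (@exists_recovering_alg _ _ _ _ _ k_gt0 U_gt0 B1 (d * r) j
          (3 * b + 12 * j + 19) b (#|U| %/ j.+1)) => //.
(* The exponent is [3 * (b + 4 * j + 6) + 1]: then [2 * k ^ 2 <= 2 * delta * k ^ 3 <= delta * 2 ^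
   l], using [delta * k >= 1]. *)
- have kl : k%:R <= 2 ^+ (b + 4 * j + 6) :> R.
    apply/ltW/(lt_le_trans kj).
    have -> : 16 = 2 ^+ 4 :> R by rewrite -natrX.
    rewrite -exprM.
    have -> : (2 ^+ (b + 4 * j + 6) : R) = 2 * 2 ^+ b.+1 * 2 ^+ (4 * j.+1).
      have -> : (b + 4 * j + 6 = b.+2 + 4 * j.+1)%N by ring.
      by rewrite exprD [2 ^+ b.+2]exprS.
    by rewrite ler_pM2r ?exprn_gt0 // ler_pM2l // ltW.
  have : k%:R ^+ 3 <= (2 ^+ (b + 4 * j + 6)) ^+ 3 :> R.
    by rewrite lerXn2r ?nnegrE ?exprn_ge0.
  rewrite -exprM => k3.
  have -> : (2 ^+ (3 * b + 12 * j + 19) : R) = 2 * 2 ^+ ((b + 4 * j + 6) * 3).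
    have -> : (3 * b + 12 * j + 19 = ((b + 4 * j + 6) * 3).+1)%N by ring.
    by rewrite exprS.
  rewrite [X in _ <= X]mulrCA ler_pM2l //.
  apply: le_trans (_ : delta * k%:R ^+ 3 <= _); last by rewrite ler_pM2l.
  by rewrite [k%:R ^+ 3]exprS mulrA ler_peMl // exprn_ge0.
- move=> P bP; have [pP _ _] := bP.
  have fib (y : {set U}) : (#|[set v | pblock P v == y]| <= max_cluster U k B)%N.
    have [yP|yP] := boolP (y \in P).
      apply: leq_trans (balanced_card_le bP yP).
      apply: subset_leq_card; apply/subsetP => v; rewrite inE.
      by rewrite (partition_pblockP _ pP yP).
    rewrite eq_card0 // => v; rewrite !inE; apply: contraNF yP => /eqP <-.
    by rewrite pblock_mem //; have /and3P[/eqP -> _ _] := pP; rewrite inE.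
  have sm : (2 * (s.-1 ^ 2 * max_cluster U k B) <= #|U|)%N.
    (* For [j = 0] groups are single points and [s.-1 = 0], so large clusters do no harm. *)
    case/orP: jk => [/eqP j0|jk].
      by rewrite /s j0 /= exp0n.
    have ss : (s.-1 ^ 2 <= 16 ^ j)%N.
      rewrite (_ : 16 = 4 ^ 2)%N // -expnM mulnC expnM leq_exp2r //.
      by apply: leq_trans (leq_pred _) (weighing_capacity_le j).
    have ssR : (s.-1 ^ 2)%:R <= 16 ^+ j :> R by rewrite -natrX ler_nat.
    rewrite -(ler_nat R) [(2 * _)%:R]natrM [(_ * max_cluster _ _ _)%:R]natrM.
    apply: le_trans (_ : 2 * (16 ^+ j * (B * #|U|%:R / k%:R)) <= _).
      by rewrite ler_pM2l // ler_pM // max_cluster_le.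
    have -> : 2 * (16 ^+ j * (B * #|U|%:R / k%:R)) =
              (2 * B * 16 ^+ j) / k%:R * #|U|%:R :> R by ring.
    by rewrite ger_pMl // ler_pdivrMr // mul1r.
  have ds : (2 * #|U| <= d * s)%N by rewrite /d ltnW // ltn_ceil.
  have := card_missed_gt fib sm r (#|U| %/ j.+1) s0 ds.
  rewrite -(ler_nat R) !natrM natrX; set bad := #|[set _ | _]|.
  set tot := #|{: {ffun 'I_(d * r) -> _}}|.
  set m1 := (_ %/ _).+1 => h.
  have m1U : #|U|%:R <= m1%:R * j.+1%:R :> R.
    by rewrite -natrM ler_nat ltnW // ltn_ceil.
  have tot0 : 0 <= tot%:R :> R by [].
  have m10 : 0 < m1%:R :> R by [].
  have {}h : bad%:R * 2 ^+ r <= j.+1%:R * tot%:R :> R.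
    rewrite -(ler_pM2l m10).
    have := ler_wpM2r tot0 m1U; lra.
  move: r1; rewrite ler_pdivrMr // => r1.
  have p0 : 0 < 2 ^+ r :> R by rewrite exprn_gt0.
  rewrite -(ler_pM2r p0).
  have := ler_wpM2r tot0 r1; lra.
(* [3195 * 8 * 7 = 178920] is below the constant [2 * 10 ^ 5]. *)
apply: le_trans (_ : (3195 * (b.+1 ^ 2 * (#|U| * r)))%:R <= _).
  by rewrite ler_nat; exact: (budget_le b r0 jU sU).
rewrite natrM [(b.+1 ^ 2 * _)%:R]natrM natrX natrM.
have h1 := sqr_exponent_le b1.
have h2 : #|U|%:R * r%:R <= #|U|%:R * (7 * mu) by rewrite ler_pM2l.
have h3 : b.+1%:R ^+ 2 * (#|U|%:R * r%:R) <=
          8 * Num.sqrt B * (#|U|%:R * (7 * mu)).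
  by rewrite ler_pM ?exprn_ge0 ?mulr_ge0.
have : 0 <= Num.sqrt B * #|U|%:R * mu.
  by rewrite !mulr_ge0 ?sqrtr_ge0 // (le_trans _ mu_ge1).
lra.
Qed.

End Regimes.

(** The hypotheses come after the existential so that the algorithm can be chosen as a total
    function of the parameters; [constant_alg] fills the values outside the domain. *)
Lemma exists_two_round_alg (R : realType) (U : finType) (k : nat) (B delta : R) :
  exists A : rand_two_round_alg R U, 0 < delta -> 1 <= B ->
    recovers_balanced A k B delta
      (2 * 10 ^+ 5 * (Num.sqrt B * #|U|%:R * Num.max 1 (ln (ln k%:R / delta)))).
Proof.
have [d0|d0] := ltP 0 delta; last by exists (constant_alg R U k).
have [B1|B1] := leP 1 B; last by exists (constant_alg R U k).
have [triv|] := boolP [|| 1 <= delta, (k <= 1)%N | (#|U| < k)%N].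
  exists (constant_alg R U k) => _ _; apply: constant_alg_recovers => //.
  by rewrite !mulr_ge0 ?exprn_ge0 ?sqrtr_ge0 // le_max ler01.
rewrite !negb_or -ltNge -ltnNge -leqNgt => /and3P[d1 k2 kU].
have [dk|dk] := leP (delta * k%:R) 1.
  by have [A hA] := exists_alg_small_delta k2 kU B1 d0 d1 dk; exists A.
by have [A hA] := exists_alg_large_delta k2 kU B1 d0 d1 (ltW dk); exists A.
Qed.

Lemma recovers_balanced_le (R : realType) (U : finType)
    (A : rand_two_round_alg R U) k (B delta q q' : R) :
  q <= q' -> recovers_balanced A k B delta q -> recovers_balanced A k B delta q'.
Proof.
move=> qq h P bP; have [h1 h2] := h P bP.
by split=> // w; apply: le_trans qq.
Qed.

(** Reduces a polynomial in [ln k] to one power, whose logarithm is O(ln ln k). *)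
Lemma horner_le_exp (R : realType) (p : {poly R}) :
  exists2 C : R, 1 <= C & forall x, 1 <= x -> p.[x] <= C * x ^+ size p.
Proof.
exists (1 + \sum_(i < size p) `|p`_i|); first by rewrite lerDl sumr_ge0.
move=> x x1; have x0 : 0 <= x by exact: le_trans x1.
apply: le_trans (_ : (\sum_(i < size p) `|p`_i|) * x ^+ size p <= _); last first.
  by rewrite ler_wpM2r ?exprn_ge0 // lerDr.
rewrite horner_coef mulr_suml; apply: ler_sum => i _.
apply: le_trans (_ : `|p`_i| * x ^+ i <= _).
  by rewrite ler_wpM2r ?exprn_ge0 // ler_norm.
by rewrite ler_wpM2l // ler_weXn2l // ltnW.
Qed.

(* The O(.) bound is meant for ln k / delta bounded away from 1 (outside of    *)
(* that range the logarithm may vanish or be negative): the literal formula is *)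
(* asserted for k >= 3 and delta < 1, and for all parameters the one with      *)
(* max(1, ln(ln k / delta)).                                                   *)
Theorem theorem5p2 (R : realType) :
  exists A : forall U : finType, nat -> R -> R -> rand_two_round_alg R U,
    (exists c : R, forall (U : finType) (k : nat) (B delta : R),
       0 < delta -> 1 <= B ->
       recovers_balanced (A U k B delta) k B delta
         (c * (Num.sqrt B * #|U|%:R * Num.max 1 (ln (ln k%:R / delta)))) /\
       ((3 <= k)%N -> delta < 1 ->
        recovers_balanced (A U k B delta) k B delta
          (c * (Num.sqrt B * #|U|%:R * ln (ln k%:R / delta))))) /\
    (forall (B : R) (p : {poly R}), 1 <= B ->
       exists c : R, forall (U : finType) (k : nat) (delta : R),
         (3 <= k)%N -> 0 < delta -> delta^-1 <= p.[ln k%:R] ->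
         recovers_balanced (A U k B delta) k B delta
           (c * (#|U|%:R * ln (ln k%:R)))).
Proof.
pose c1 : R := 2 * 10 ^+ 5.
have c10 : 0 <= c1 by rewrite mulr_ge0 ?exprn_ge0.
pose c0 : R := ln (ln 3).
have c00 : 0 < c0 by rewrite ln_gt0 // ln3_gt1.
have lnk (k : nat) : (3 <= k)%N -> ln 3 <= ln k%:R :> R.
  by move=> k3; rewrite ler_ln ?posrE ?ler_nat // ltr0n (leq_trans _ k3).
exists (fun U k B delta => projT1 (cid (exists_two_round_alg U k B delta))).
split.
  (* For [y >= c0], [max 1 y <= (1 + 1 / c0) * y]; the bound [c0 = ln (ln 3)] is the worst case of
     [k >= 3], [delta < 1]. *)
  pose K : R := 1 + c0^-1; exists (c1 * K) => U k B delta d0 B1.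
  have hA := projT2 (cid (exists_two_round_alg U k B delta)) d0 B1.
  have X0 : 0 <= Num.sqrt B * #|U|%:R by rewrite mulr_ge0 ?sqrtr_ge0.
  have c0V : 0 < c0^-1 by rewrite invr_gt0.
  split=> [|k3 d1]; apply: recovers_balanced_le hA.
    rewrite -/c1 -[X in _ <= X]mulrA ler_wpM2l // ler_peMl //.
      by rewrite mulr_ge0 // le_max ler01.
    by rewrite lerDl ltW.
  rewrite -/c1 -[X in _ <= X]mulrA ler_wpM2l // [K * _]mulrCA ler_wpM2l //.
  set y := ln _.
  have hy : c0 <= y.
    have l3 := ln3_gt1 R; have lk := lnk k k3.
    have k0 : 0 < ln k%:R :> R by lra.
    rewrite ler_ln ?posrE ?divr_gt0 //; last by lra.
    by apply: le_trans lk _; rewrite ler_pMr // invf_ge1 // ltW.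
  have h1 : 1 <= c0^-1 * y by rewrite mulrC ler_pdivlMr // mul1r.
  have y0 : 0 <= y by apply: le_trans hy; exact: ltW.
  by rewrite ge_max mulrDl mul1r; apply/andP; split; lra.
move=> B p B1; have [C C1 hC] := horner_le_exp p.
have lnC : 0 <= ln C by exact: ln_ge0.
(* The additive [1 + ln C] becomes a multiple of [ln (ln k) >= c0]; the exponent is [(size p).+1]
   because [ln k / delta] carries one more factor [ln k]. *)
exists (c1 * Num.sqrt B * ((1 + ln C) / c0 + (size p).+1%:R)) => U k delta k3 d0 dp.
have hA := projT2 (cid (exists_two_round_alg U k B delta)) d0 B1.
apply: recovers_balanced_le hA; rewrite -/c1.
have l3 := ln3_gt1 R; have lk := lnk k k3.
set y := ln k%:R in dp lk *.
have y1 : 1 < y by lra.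
have y0 : 0 < y by lra.
have zc : c0 <= ln y by rewrite ler_ln ?posrE //; lra.
have h1 : ln (y / delta) <= ln C + (size p).+1%:R * ln y.
  have : y / delta <= C * y ^+ (size p).+1.
    rewrite exprS mulrCA ler_wpM2l ?(ltW y0) //.
    by apply: le_trans dp _; apply: hC; exact: ltW.
  have C0 : 0 < C by lra.
  rewrite -ler_ln ?posrE ?divr_gt0 ?mulr_gt0 ?exprn_gt0 //.
  by rewrite [ln (C * _)]lnM ?posrE ?exprn_gt0 // lnXn // -[ln y *+ _]mulr_natl.
have h2 : 1 + ln C <= (1 + ln C) / c0 * ln y.
  by rewrite mulrAC ler_pdivlMr // ler_wpM2l // addr_ge0.
have z0 : 0 <= (size p).+1%:R * ln y.
  by rewrite mulr_ge0 // (le_trans _ zc) // ltW.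
have h3 : Num.max 1 (ln (y / delta)) <= ((1 + ln C) / c0 + (size p).+1%:R) * ln y.
  by rewrite ge_max mulrDl; apply/andP; split; lra.
have -> : c1 * Num.sqrt B * ((1 + ln C) / c0 + (size p).+1%:R) * (#|U|%:R * ln y)
  = c1 * (Num.sqrt B * #|U|%:R * (((1 + ln C) / c0 + (size p).+1%:R) * ln y)).
  by rewrite !mulrA; ring.
by rewrite !ler_wpM2l ?mulr_ge0 ?sqrtr_ge0.
Qed.
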